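(* Let $a<b$ be positive odd integers with $a\neq1$. Then there is no infinite smooth word over $\{a,b\}$ that is also an infinite Lyndon word.
   Context: Words over $\{a,b\}$ are compared lexicographically with $a<b$. For a word $w$ over $\{a,b\}$ written as maximal blocks $\alpha_0^{i_0}\alpha_1^{i_1}\cdots$ ($\alpha_{k+1}\ne\alpha_k$, $i_k\ge1$), $\Delta(w)=i_0i_1\cdots$. An infinite word $w\in\{a,b\}^\omega$ is smooth if $\Delta^k(w)\in\{a,b\}^\omega$ for all $k\ge0$. An infinite Lyndon word is an infinite word strictly smaller than each of its proper suffixes. *)

(* Defs.v *)
From mathcomp Require Import all_boot.

Set Implicit Arguments.
Unset Strict Implicit.
Unset Printing Implicit Defensive.

Definition infword := nat -> nat.

Definition over (a b : nat) (w : infword) : Prop :=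
  forall i, w i = a \/ w i = b.

Definition lex_lt (u v : infword) : Prop :=
  exists n, (forall i, i < n -> u i = v i) /\ u n < v n.

Definition suffix_from (n : nat) (w : infword) : infword := fun i => w (n + i).

Definition infinite_Lyndon (w : infword) : Prop :=
  forall n, 0 < n -> lex_lt w (suffix_from n w).

Definition block_start (d : infword) (k : nat) : nat := \sum_(j < k) d j.

(* Graph of the partial operator Delta on infinite words: w is the
   concatenation of the maximal blocks (alpha 0)^(d 0) (alpha 1)^(d 1) ...
   It is undefined exactly when w is eventually constant, where Delta w would
   not be an infinite word of integers. *)
Definition is_Delta (w d : infword) : Prop :=
  exists alpha : infword,
    [/\ forall k, 0 < d k,
        forall k, alpha k.+1 <> alpha k
      & forall k i, i < d k -> w (block_start d k + i) = alpha k].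

Fixpoint is_Delta_iter (k : nat) (w v : infword) : Prop :=
  if k is k'.+1 then exists2 u, is_Delta_iter k' w u & is_Delta u v
  else w = v.

Definition smooth (a b : nat) (w : infword) : Prop :=
  forall k, exists2 v, is_Delta_iter k w v & over a b v.

Lemma is_Delta_functional (w d e : infword) :
  is_Delta w d -> is_Delta w e -> d =1 e.
Proof.
move=> [al [d0 ad dw]] [be [e0 be_ ew]].
have bsS f k : block_start f k.+1 = block_start f k + f k.
  by rewrite /block_start big_ord_recr.
have step (f g al' be' : infword) k : (forall k, 0 < g k) -> (forall k, 0 < f k) ->
    (forall k, al' k.+1 <> al' k) ->
    (forall k i, i < f k -> w (block_start f k + i) = al' k) ->
    (forall k i, i < g k -> w (block_start g k + i) = be' k) ->
    block_start f k = block_start g k -> g k <= f k.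
  move=> g0 f0 af fw gw E; rewrite leqNgt; apply/negP => lt.
  have h1 := gw k _ lt; have h0 := gw k 0 (g0 k).
  have h2 := fw k 0 (f0 k); have h3 := fw k.+1 0 (f0 k.+1).
  apply: (af k); rewrite -h2 -h3 !addn0 bsS E h1.
  by rewrite -h0 addn0.
have E k : block_start d k = block_start e k.
  elim: k => [|k IH]; first by rewrite /block_start !big_ord0.
  rewrite !bsS IH; congr (_ + _); apply/eqP; rewrite eqn_leq.
  by rewrite (step e d be al) // (step d e al be).
by move=> k; apply/eqP; rewrite eqn_leq (step e d be al) // (step d e al be).
Qed.

(* Main.v *)
From mathcomp Require Import all_boot zify.
Require Import Defs.

Set Implicit Arguments.
Unset Strict Implicit.
Unset Printing Implicit Defensive.

(** Only [w], [d = Delta w] and [e = Delta (Delta w)] matter.  The word [w]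
    must start with [a], so its blocks at even positions consist of [a]'s.
    All blocks of [d] have odd length at least 3.  If [d] starts with [a], then
    its second block has a [b] at an even position, so [a^b] occurs in
    [w = a^a b ...] and starts a smaller suffix.  If [d] starts with [b], then
    [w = a^b b^b ...], while the last letter of the first block of [d] is a [b]
    at an even position followed by an [a], so [a^b b^a a] occurs in [w] and
    starts a smaller suffix. *)

Lemma lex_lt_asym (u v : infword) : lex_lt u v -> ~ lex_lt v u.
Proof.
move=> [m [eqm ltm]] [n [eqn ltn]].
case: (ltngtP m n) => [lt|lt|E].
- by rewrite (eqn _ lt) ltnn in ltm.
- by rewrite (eqm _ lt) ltnn in ltn.
- by rewrite E ltnNge (ltnW ltn) in ltm.
Qed.

Lemma block_start0 (d : infword) : block_start d 0 = 0.
Proof. by rewrite /block_start big_ord0. Qed.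

Lemma block_startS (d : infword) k :
  block_start d k.+1 = block_start d k + d k.
Proof. by rewrite /block_start big_ord_recr. Qed.

Lemma block_start_gt0 (d : infword) k :
  (forall k, 0 < d k) -> 0 < k -> 0 < block_start d k.
Proof. by case: k => // k d_gt0 _; rewrite block_startS addn_gt0 d_gt0 orbT. Qed.

(** With two letters, [al k] and [al k.+2] both differ from [al k.+1], hence coincide. *)
Lemma over_alternating (a b : nat) (al : infword) : over a b al ->
  (forall k, al k.+1 <> al k) -> forall k, al k.*2 = al 0.
Proof.
move=> al_ab al_neq; elim=> // k <-; rewrite doubleS.
have := al_neq k.*2; have := al_neq k.*2.+1.
by case: (al_ab k.*2) => ->; case: (al_ab k.*2.+1) => ->;
  case: (al_ab k.*2.+2) => ->.
Qed.

Lemma smooth_Delta2 (a b : nat) (w : infword) : smooth a b w ->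
  exists d e, [/\ is_Delta w d, is_Delta d e, over a b w, over a b d
                & over a b e].
Proof.
move=> smw.
have [_ <- w_ab] := smw 0.
have [d1 [_ <- wd1] d1_ab] := smw 1.
have [e [d [_ <- wd] de] e_ab] := smw 2.
(* [d] and [d1] come from separate instances of smoothness; uniqueness of Delta carries the alphabet
   from [d1] over to [d]. *)
exists d, e; split=> // i.
by rewrite (is_Delta_functional wd wd1); apply: d1_ab.
Qed.

Theorem theorem22 (a b : nat) (ha : 0 < a) (hab : a < b) (oa : odd a) (ob : odd b)
    (ha1 : a <> 1) :
  ~ (exists w : infword, smooth a b w /\ infinite_Lyndon w).
Proof.
move=> [w [/smooth_Delta2 [d [e [wd de w_ab d_ab e_ab]]] lynw]].
have no_smaller n m : 0 < n -> (forall i, i < m -> w (n + i) = w i) ->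
    w (n + m) < w m -> False.
  move=> n_gt0 eqm ltm.
  by apply: (lex_lt_asym (lynw n n_gt0)); exists m.
have [al [d_gt0 al_neq walE]] := wd.
have [be [e_gt0 be_neq dbeE]] := de.
have al_ab : over a b al.
  by move=> k; rewrite -(walE k 0 (d_gt0 k)); apply: w_ab.
have be_ab : over a b be.
  by move=> k; rewrite -(dbeE k 0 (e_gt0 k)); apply: d_ab.
have e_odd k : odd (e k) by case: (e_ab k) => ->.
have e_ge3 k : 2 < e k by case: (e_ab k) => ->; lia.
have w0E i : i < d 0 -> w i = al 0.
  by move=> /walE; rewrite block_start0.
have w1E i : i < d 1 -> w (d 0 + i) = al 1.
  by move=> /walE; rewrite block_startS block_start0.
(* Otherwise the suffix at the second block starts with [a], below [w 0 = b]. *)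
have al0 : al 0 = a.
  case: (al_ab 0) => // al0b.
  have al1a : al 1 = a by have := al_neq 0; case: (al_ab 1) => //; lia.
  case: (no_smaller (d 0) 0) => //.
  by rewrite w1E // w0E // al1a al0b.
have al_even k : ~~ odd k -> al k = a.
  move=> /even_halfK <-; rewrite -al0.
  exact: over_alternating al_ab al_neq _.
have al_odd k : odd k -> al k = b.
  move=> ok; have := al_neq k; rewrite (al_even k.+1) /= ?ok //.
  by case: (al_ab k) => ->.
case: (be_ab 0) => be0.
  have be1 : be 1 = b by have := be_neq 0; case: (be_ab 1) => //; lia.
  have d0 : d 0 = a by have := dbeE 0 0 (e_gt0 0); rewrite block_start0 be0.
  (* The second block of [d] starts at the odd index [e 0]; its second letter, present since
     [e 1 > 1], has even index. *)
  pose p := e 0 + 1.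
  have dp : d p = b.
    by rewrite -be1 -(dbeE 1 1) ?block_startS ?block_start0 // ltnW.
  have alp : al p = a by apply: al_even; have := e_odd 0; rewrite /p; lia.
  (* At offset [a], [w] has left its first block, while block [p], of length [b > a], still reads
     [a]. *)
  apply: (no_smaller (block_start d p) a).
  - by apply: block_start_gt0; rewrite // /p addn1.
  - by move=> i ia; rewrite walE ?dp ?(ltn_trans ia) // w0E ?d0 // alp al0.
  - by rewrite walE ?dp // alp -[X in w X]addn0 -{2}d0 w1E // al_odd.
have dE0 i : i < e 0 -> d i = b.
  by move=> /(dbeE 0); rewrite block_start0 be0.
have d0 : d 0 = b by apply: dE0.
have d1 : d 1 = b by apply: dE0; rewrite ltnW.
pose p := (e 0).-1.
have pS : p.+1 = e 0 by rewrite prednK.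
have p_even : ~~ odd p by have := e_odd 0; rewrite -pS.
have dp : d p = b by apply: dE0; rewrite -pS.
have dpS : d p.+1 = a.
  have be1 : be 1 = a by have := be_neq 0; case: (be_ab 1) => //; lia.
  by have := dbeE 1 0 (e_gt0 1); rewrite block_startS block_start0 addn0 -pS be1.
(* After the common [a^b b^a], block [p.+2] supplies an [a], while the second block of [w], of
   length [b > a], still reads [b]. *)
apply: (no_smaller (block_start d p) (b + a)).
- by apply: block_start_gt0; rewrite // -ltnS pS ltnW.
- move=> i lti; case: (ltnP i b) => [ltib|leib].
    by rewrite walE ?dp // w0E ?d0 // al0 al_even.
  rewrite -(subnKC leib) addnA -{1}dp -block_startS walE; last by rewrite dpS; lia.
  by rewrite -d0 w1E ?d0 ?d1 ?al_odd //; lia.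
- rewrite addnA -{1}dp -block_startS -{1}dpS -block_startS -[X in w X]addn0.
  by rewrite walE // al_even /= ?negbK // -{1}d0 w1E ?d1 // al_odd.
Qed.
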